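(* Let $\chi<\kappa$ be infinite regular cardinals, and let $\theta\le\kappa$ be an infinite regular cardinal. Suppose that a coloring $c:[\kappa]^2\rightarrow\theta$ witnesses $\mathrm{U}_1(\kappa,2,\theta,\chi)$, and $\lambda$ is some cardinal. Then: (1) $F_{c,\chi}$ is a $\chi$-complete uniform filter on $\theta$; (2) if every $\chi$-complete uniform filter on $\theta$ is not weakly $\lambda$-saturated, then $\mathrm{Pr}_1(\kappa,\kappa,\lambda,\chi)$ holds.
   Context: Work in ZFC. For sets of ordinals $a,b$, write $a<b$ iff $\alpha<\beta$ for all $\alpha\in a$ and $\beta\in b$. For an ordinal $\sigma$, $[\kappa]^\sigma$ is the collection of all subsets of $\kappa$ of order type $\sigma$. As an exception, $[\kappa]^2:=\{(\alpha,\beta)\mid \alpha<\beta<\kappa\}$, and for a collection $\mathcal A$ of sets of ordinals, $[\mathcal A]^2:=\{(a,b)\in\mathcal A\times\mathcal A\mid a<b\}$. A coloring $c:[\kappa]^2\rightarrow\theta$ witnesses $\mathrm{U}_1(\kappa,2,\theta,\chi)$ iff for every $\sigma<\chi$, every pairwise disjoint subfamily $\mathcal A\subseteq[\kappa]^\sigma$ of size $\kappa$, and every $\epsilon<\theta$, there exist $(a,b)\in[\mathcal A]^2$ and $\tau<\theta$ with $\tau>\epsilon$ such that $c[a\times b]=\{\tau\}$. $\mathrm{Pr}_1(\kappa,\kappa,\lambda,\chi)$ asserts the existence of a coloring $c:[\kappa]^2\rightarrow\lambda$ such that for every $\sigma<\chi$, every pairwise disjoint subfamily $\mathcal A\subseteq[\kappa]^\sigma$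 of size $\kappa$, and every $\tau<\lambda$, there is $(a,b)\in[\mathcal A]^2$ such that $c[a\times b]=\{\tau\}$. Let $\mathbb A^\kappa_\chi$ denote the collection of all pairwise disjoint subfamilies $\mathcal A\subseteq\mathcal P(\kappa)$ such that $|\mathcal A|=\kappa$ and $\sup\{|a|\mid a\in\mathcal A\}<\chi$. Given $c:[\kappa]^2\rightarrow\theta$ and $\mathcal A\subseteq\mathcal P(\kappa)$, let $T_c(\mathcal A)$ be the set of all $\tau<\theta$ such that $c[a\times b]=\{\tau\}$ for some $(a,b)\in[\mathcal A]^2$. Let $$F_{c,\chi}:=\{T\subseteq\theta\mid \exists\mathcal A\in\mathbb A^\kappa_\chi\,[T_c(\mathcal A)\subseteq T]\}.$$ A (proper) filter $F$ on $\theta$ is uniform iff every element of $F$ has cardinality $\theta$; it is $\chi$-complete iff it is closed under intersections of fewer than $\chi$ many of its elements. A subset of $\theta$ is $F$-positive iff its complement in $\theta$ is not in $F$. $F$ is weakly $\lambda$-saturated iff there is no partition of $\theta$ into $\lambda$ many $F$-positive sets. *)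

(* Defs.v *)
From mathcomp Require Import all_boot all_order.
From mathcomp Require Import all_classical wochoice.

Set Implicit Arguments.
Unset Strict Implicit.
Unset Printing Implicit Defensive.

Import Order.TTheory.
Local Open Scope classical_set_scope.
Local Open Scope card_scope.
Local Open Scope order_scope.

(* A cardinal is represented by a totally ordered type whose order is the      *)
(* membership order of an initial ordinal. The elements of K thus stand for    *)
(* the ordinals below the cardinal, and x : K is identified with below x.      *)

Definition below d (K : orderType d) (x : K) : set K := [set y | y < x].

Definition card_lt T U (A : set T) (B : set U) : Prop :=
  A #<= B /\ ~ (B #<= A).

Definition is_cardinal d (K : orderType d) : Prop :=
  well_order (<=%O : rel K) /\ forall x : K, card_lt (below x) [set: K].

Definition cofinal d (K : orderType d) (A : set K) : Prop :=
  forall x : K, exists2 y, A y & x <= y.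

(* cf(K) = K: no cofinal subset of K has cardinality smaller than K. *)
Definition infinite_regular_cardinal d (K : orderType d) : Prop :=
  [/\ is_cardinal K, infinite_set [set: K] &
      forall A : set K, cofinal A -> [set: K] #<= A].

Section Colorings.
Context {dK : Order.disp_t} (K : orderType dK).

Definition set_lt (a b : set K) : Prop :=
  forall x y : K, a x -> b y -> x < y.

(* [K]^sigma for an ordinal sigma < X. The map f is only constrained on a. *)
Definition subsets_of_type dX (X : orderType dX) (sigma : X) : set (set K) :=
  [set a | exists f : K -> X,
     (forall x y : K, a x -> a y -> x < y -> f x < f y) /\
     f @` a = below sigma].

(* [A]^2 for a family A of sets of ordinals. *)
Definition increasing_pairs (A : set (set K)) : set (set K * set K) :=
  [set ab | [/\ A ab.1, A ab.2 & set_lt ab.1 ab.2]].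

(* A coloring is defined on [K]^2 only. *)
Definition coloring (C : Type) : Type := {p : K * K | p.1 < p.2} -> C.

(* c[a x b]; it is used only when a < b, so that a x b is included in [K]^2. *)
Definition rectangle_image C (c : coloring C) (a b : set K) : set C :=
  c @` [set p | a (val p).1 /\ b (val p).2].

Definition witnesses_U1 dT (Th : orderType dT) dX (X : orderType dX)
    (c : coloring Th) : Prop :=
  forall (sigma : X) (A : set (set K)),
    A `<=` subsets_of_type sigma -> trivIset A id -> A #= [set: K] ->
    forall epsilon : Th, exists (ab : set K * set K) (tau : Th),
      [/\ increasing_pairs A ab, epsilon < tau &
          rectangle_image c ab.1 ab.2 = [set tau]].

Definition Pr1 dL (L : orderType dL) dX (X : orderType dX) : Prop :=
  exists c : coloring L, forall (sigma : X) (A : set (set K)),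
    A `<=` subsets_of_type sigma -> trivIset A id -> A #= [set: K] ->
    forall tau : L, exists2 ab : set K * set K,
      increasing_pairs A ab & rectangle_image c ab.1 ab.2 = [set tau].

(* nu is the supremum of the cardinalities of the members of A: the least      *)
(* ordinal whose cardinality bounds them all, which is necessarily a cardinal. *)
Definition is_card_sup dX (X : orderType dX) (A : set (set K)) (nu : X) : Prop :=
  (forall a, A a -> a #<= below nu) /\
  (forall mu : X, (forall a, A a -> a #<= below mu) -> nu <= mu).

(* sup {|a| | a in A} < X means that this supremum is an element of X. *)
Definition bounded_families dX (X : orderType dX) : set (set (set K)) :=
  [set A | [/\ trivIset A id, A #= [set: K] & exists nu : X, is_card_sup A nu]].

Definition rectangle_colors C (c : coloring C) (A : set (set K)) : set C :=
  [set tau | exists2 ab, increasing_pairs A ab &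
                         rectangle_image c ab.1 ab.2 = [set tau]].

Definition filter_of_coloring C (c : coloring C) dX (X : orderType dX) :
    set_system C :=
  [set T | exists2 A, bounded_families X A & rectangle_colors c A `<=` T].

End Colorings.

Section Filters.
Context {T : Type}.

Definition uniform_filter (F : set_system T) : Prop :=
  forall A, F A -> A #= [set: T].

Definition complete_filter dX (X : orderType dX) (F : set_system T) : Prop :=
  forall G : set_system T, G `<=` F -> card_lt G [set: X] ->
    F (\bigcap_(A in G) A).

(* "Filter" always means "proper filter" here. *)
Definition complete_uniform_filter dX (X : orderType dX) (F : set_system T) :
    Prop :=
  [/\ ProperFilter F, complete_filter X F & uniform_filter F].

Definition positive (F : set_system T) (A : set T) : Prop := ~ F (~` A).

Definition weakly_saturated dL (L : orderType dL) (F : set_system T) : Prop :=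
  ~ exists P : L -> set T,
      partition [set: L] P [set: T] /\ forall i : L, positive F (P i).

End Filters.

(* Main.v *)
Require Import Defs.
From mathcomp Require Import all_boot all_order.
From mathcomp Require Import all_classical.
From mathcomp Require Import wochoice.

(** Everything comes down to thinning families of sets of ordinals.

    Uniformity.  The members of a bounded family have fewer than chi elements,
    so each of them has an order type below chi; since chi < kappa and kappa is
    regular, kappa many members share the same order type ([homogenize]).  On
    such a subfamily the U_1 property applies and yields homogeneous rectangles
    whose colours are unbounded in theta.  As theta is regular, the colours of
    any bounded family have cardinality theta ([filter_of_coloring_card_ge]).
    Since theta is infinite, the empty set is then not in the filter.

    Completeness.  Given at least one and fewer than chi many bounded families
    A_i, there is one bounded family B each member of which is a union of nonempty sets, one
    from each A_i ([amalgamate]).  If a < b in B, the pieces of a and b coming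
    from A_i form an increasing pair of A_i, and a rectangle of colour tau over
    (a, b) restricts to a nonempty rectangle of colour tau over these pieces.
    Hence the colours of B are colours of every A_i
    ([filter_of_coloring_bigcap]).  B is extracted from a maximal disjoint
    family of such unions.  If that family had fewer than kappa members, its
    union would be bounded in kappa by regularity, and each A_i has a nonempty
    member above the bound, so one more union could be added.  The regularity
    of chi makes each union smaller than chi, and [homogenize] then gives a
    subfamily with a uniform bound on the cardinalities.

    Part (2).  By part (1) the hypothesis applies to the filter of c and
    partitions theta into lambda many positive sets P_i; compose c with the map sending a colour to the index of its cell.  The
    positivity of P_i says precisely that no bounded family has all its
    colours outside P_i, so every family as in Pr_1 has a homogeneous
    rectangle of new colour i. *)

Set Implicit Arguments.
Unset Strict Implicit.
Unset Printing Implicit Defensive.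

Import Order.TTheory.
Local Open Scope order_scope.
Local Open Scope card_scope.
Local Open Scope classical_set_scope.

(** * Well-orders and regular cardinals *)

Definition least d (K : orderType d) (A : set K) : set K :=
  [set x | A x /\ forall y, A y -> x <= y].

Lemma well_order_least d (K : orderType d) (A : set K) :
  well_order (<=%O : rel K) -> A !=set0 -> least A !=set0.
Proof.
move=> Kwo [x Ax]; have [|m [[Am mA] _]] := Kwo [pred y | `[< A y >]].
  by exists x; rewrite inE.
exists m; split; first by move: Am; rewrite inE.
by move=> y Ay; apply: mA; rewrite inE.
Qed.

Lemma well_order_wf d (K : orderType d) :
  well_order (<=%O : rel K) -> well_founded (fun x y : K => x < y).
Proof.
move=> Kwo x; apply: contrapT => nAx.
have [|m [nAm mmin]] :=
  @well_order_least _ K [set y | ~ Acc (fun u v : K => u < v) y] Kwo.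
  by exists x.
apply: nAm; constructor => y ym; apply: contrapT => /mmin.
by rewrite leNgt ym.
Qed.

Lemma not_cofinalP d (K : orderType d) (A : set K) :
  ~ cofinal A <-> exists x, A `<=` below x.
Proof.
split=> [/existsNP[x Ax]|[x Ax] /(_ x)[y /Ax/=]]; last first.
  by rewrite /below/= ltNge => /negP.
exists x => y Ay; rewrite /below/= ltNge; apply/negP => xy.
by apply: Ax; exists y.
Qed.

Lemma regular_inhabited d (K : orderType d) :
  infinite_regular_cardinal K -> exists x : K, True.
Proof. by case=> _ /infinite_setN0[x _] _; exists x. Qed.

Lemma not_card_le_below d (K : orderType d) (x : K) :
  infinite_regular_cardinal K -> ~ ([set: K] #<= below x).
Proof. by move=> [[_ /(_ x)[]]]. Qed.

Lemma regular_no_max d (K : orderType d) (x : K) :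
  infinite_regular_cardinal K -> exists y, x < y.
Proof.
move=> [_ Kinf Kreg]; apply: contrapT => xmax.
apply: Kinf; apply: (@card_le_finite _ _ _ [set x]) => //.
apply: Kreg => y; exists x => //; rewrite leNgt; apply/negP => xy.
by apply: xmax; exists y.
Qed.

(** Regularity in the form used below: were each piece bounded, the fewer than
    K bounds would themselves be bounded, and so would be the union. *)
Lemma cofinal_bigcup d (K : orderType d) T (I : set T) (A : T -> set K) :
  infinite_regular_cardinal K -> ~ ([set: K] #<= I) ->
  cofinal (\bigcup_(i in I) A i) -> exists2 i, I i & cofinal (A i).
Proof.
move=> hK KI cofA; apply: contrapT => nA.
have [x0 _] := regular_inhabited hK.
pose g i := xget x0 [set x | A i `<=` below x].
have Ag i : I i -> A i `<=` below (g i).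
  move=> Ii; apply: (@xgetPex _ x0 [set x | A i `<=` below x]).
  by apply/not_cofinalP => cA; apply: nA; exists i.
have /not_cofinalP[x gx] : ~ cofinal (g @` I).
  case: hK => _ _ Kreg /Kreg Kg; apply: KI.
  exact: card_le_trans Kg (card_image_le _ _).
have [y [i Ii Aiy] xy] := cofA x.
have := lt_trans (Ag _ Ii _ Aiy) (gx _ (imageP g Ii)).
by rewrite ltNge xy.
Qed.

(** An injection of K into A pulls the cover back to a cover of K by fewer than
    K sets; one of these is cofinal, hence of size K by regularity. *)
Lemma pigeonhole d (K : orderType d) T (I : set T) U
    (S : T -> set U) (A : set U) :
  infinite_regular_cardinal K -> ~ ([set: K] #<= I) -> [set: K] #<= A ->
  A `<=` \bigcup_(i in I) S i -> exists2 i, I i & [set: K] #<= A `&` S i.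
Proof.
move=> hK KI KA AS; elim/Ppointed: U => U in S A KA AS *.
  move: KA; rewrite card_le_emptyr => /eqP K0.
  by case: hK => _ /infinite_setN0/set0P; rewrite K0 eqxx.
move: KA => /pcard_leP/unsquash f.
have [|i Ii cofi] := @cofinal_bigcup _ K _ I (fun i => f @^-1` S i) hK KI.
  move=> x; exists x => //.
  have /AS[i Ii Si] : A (f x) by exact: funS.
  by exists i.
exists i => //; case: hK => _ _ /(_ _ cofi) Ki.
apply: card_le_trans Ki _.
have finj : {in f @^-1` S i &, injective f}.
  by move=> x y _ _; apply: (@inj _ _ _ f); rewrite inE.
rewrite -(card_le_eql (inj_card_eq finj)); apply: subset_card_le.
by move=> _ [x Six <-]; split => //; exact: funS.
Qed.

(** The Mostowski collapse of a: send each element to the least ordinal of X not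
    taken by a smaller element of a.  As a is too small to exhaust X, such an
    ordinal always exists, and the first ordinal missed by all of a is its
    order type. *)
Lemma collapse dK (K : orderType dK) dX (X : orderType dX) (a : set K) :
  well_order (<=%O : rel K) -> well_order (<=%O : rel X) ->
  ~ ([set: X] #<= a) -> exists sigma : X, subsets_of_type sigma a.
Proof.
move=> Kwo Xwo Xa.
have [x0 _] : [set: X] !=set0.
  by apply/set0P/negP => /eqP X0; apply: Xa; rewrite X0.
have Kwf := well_order_wf Kwo.
(* One step of the recursion; x0 is only a default for xget. *)
pose step (x : K) (rec : forall y, y < x -> X) : X :=
  xget x0 (least (~` [set z | exists y (yx : y < x), a y /\ rec y yx = z])).
pose f : K -> X := Fix Kwf (fun=> X) step.
have fE x : f x = xget x0 (least (~` (f @` (a `&` below x)))).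
  rewrite /f Fix_eq -/f; last first.
    move=> y g h gh; congr (step y _).
    by apply: functional_extensionality_dep => z; apply: functional_extensionality_dep.
  congr (xget x0 (least (~` _))); apply/seteqP; split => z /=.
    by move=> [y [yx [ay <-]]]; exists y.
  by move=> [y [ay yx] <-]; exists y, yx.
have missed (b : set K) : b `<=` a -> ~` (f @` b) !=set0.
  move=> ba; apply/set0P/negP => /eqP fb; apply: Xa.
  rewrite -setC0 -fb setCK; apply: card_le_trans (card_image_le _ _) _.
  exact: subset_card_le.
have fleast x : least (~` (f @` (a `&` below x))) (f x).
  rewrite fE; apply: (@xgetPex _ x0 (least _)); apply: well_order_least => //.
  by apply: missed => y [].
have fmono x y : a x -> a y -> x < y -> f x < f y.
  move=> ax ay xy; have [_ fxmin] := fleast x; have [fyN _] := fleast y.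
  rewrite lt_neqAle; apply/andP; split.
    by apply/eqP => fxy; apply: fyN; exists x.
  apply: fxmin => -[z [az zx] fz]; apply: fyN; exists z => //.
  by split => //; exact: lt_trans zx xy.
have [sigma [sN smin]] := well_order_least Xwo (missed a (@subset_refl _ a)).
exists sigma, f; split => //; apply/seteqP; split => [_ [x ax <-]|z zs].
  rewrite /below/= ltNge; apply/negP => sx.
  have [fxN fxmin] := fleast x.
  have [sfx|] := pselect (sigma = f x); first by apply: sN; exists x.
  move=> /eqP sfx; have : sigma < f x by rewrite lt_neqAle sfx.
  rewrite ltNge => /negP; apply; apply: fxmin => -[y [ay _] fy].
  by apply: sN; exists y.
by apply: contrapT => /smin; rewrite leNgt zs.
Qed.

(** * Families of small sets *)

Lemma card_le_regular_below d (K : orderType d) T (A : set T) (x : K) :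
  infinite_regular_cardinal K -> A #<= below x -> ~ ([set: K] #<= A).
Proof.
by move=> hK Ax KA; apply: (@not_card_le_below _ K x hK); exact: card_le_trans Ax.
Qed.

Lemma subsets_of_type_card_le dK (K : orderType dK) dX (X : orderType dX)
    (sigma : X) (a : set K) :
  subsets_of_type sigma a -> a #<= below sigma.
Proof.
move=> [f [fmono fa]].
have finj : {in a &, injective f}.
  move=> x y; rewrite !inE => ax ay fxy; apply/eqP.
  by case: ltgtP => // xy; [have := fmono _ _ ax ay xy|have := fmono _ _ ay ax xy];
    rewrite fxy ltxx.
by rewrite -fa (card_le_eqr (inj_card_eq finj)).
Qed.

(** There are at most X < K many possible order types for K many sets. *)
Lemma homogenize dK (K : orderType dK) dX (X : orderType dX)
    (A : set (set K)) :
  infinite_regular_cardinal K -> infinite_regular_cardinal X ->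
  card_lt [set: X] [set: K] -> [set: K] #<= A ->
  (forall a, A a -> ~ ([set: X] #<= a)) ->
  exists (sigma : X) (B : set (set K)),
    [/\ B `<=` A, B `<=` subsets_of_type sigma & B #= [set: K]].
Proof.
move=> hK hX [_ nKX] KA Asmall.
have [|sigma _ KB] := pigeonhole (S := fun sigma : X => subsets_of_type sigma)
  hK nKX KA.
  move=> a Aa; have [||sigma sa] := @collapse _ K _ X a _ _ (Asmall a Aa).
  - by case: hK => [[]].
  - by case: hX => [[]].
  by exists sigma.
have [B BK BA] := card_subP _ _ KB.
by exists sigma, B; split => // a /BA[].
Qed.

Lemma bounded_family_of_type dK (K : orderType dK) dX (X : orderType dX)
    (sigma : X) (A : set (set K)) :
  well_order (<=%O : rel X) -> A `<=` subsets_of_type sigma -> trivIset A id ->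
  A #= [set: K] -> bounded_families X A.
Proof.
move=> Xwo As tA AK; split => //.
have [|nu [nuA numin]] :=
  @well_order_least _ X [set nu | forall a, A a -> a #<= below nu] Xwo.
  by exists sigma => a /As; exact: subsets_of_type_card_le.
by exists nu.
Qed.

Lemma bounded_family_card dK (K : orderType dK) dX (X : orderType dX)
    (A : set (set K)) :
  infinite_regular_cardinal X -> bounded_families X A ->
  forall a, A a -> ~ ([set: X] #<= a).
Proof.
by move=> hX [_ _ [nu [Anu _]]] a /Anu; exact: card_le_regular_below.
Qed.

(** Sets that are merely smaller than X one by one may have cardinalities
    cofinal in X; passing to a single order type restores a uniform bound. *)
Lemma bounded_subfamily dK (K : orderType dK) dX (X : orderType dX)
    (A : set (set K)) :
  infinite_regular_cardinal K -> infinite_regular_cardinal X ->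
  card_lt [set: X] [set: K] -> trivIset A id -> [set: K] #<= A ->
  (forall a, A a -> ~ ([set: X] #<= a)) ->
  exists2 B, B `<=` A & bounded_families X B.
Proof.
move=> hK hX XK tA KA Asmall.
have [sigma [B [BA Bs BK]]] := homogenize hK hX XK KA Asmall.
exists B => //; apply: (bounded_family_of_type (sigma := sigma)) => //.
  by case: hX => [[]].
exact: sub_trivIset BA tA.
Qed.

(** * The filter of a coloring *)

Lemma rectangle_colorsS dK (K : orderType dK) C (c : coloring K C)
    (A B : set (set K)) :
  A `<=` B -> rectangle_colors c A `<=` rectangle_colors c B.
Proof. by move=> AB tau [ab [/AB ? /AB ? ?] ?]; exists ab. Qed.

(** The colours of a bounded family are cofinal in Th, because U_1 provides
    colours above any given one on a subfamily of constant order type. *)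
Lemma filter_of_coloring_card_ge dK (K : orderType dK) dT (Th : orderType dT)
    dX (X : orderType dX) (c : coloring K Th) (T : set Th) :
  infinite_regular_cardinal K -> infinite_regular_cardinal X ->
  card_lt [set: X] [set: K] -> infinite_regular_cardinal Th ->
  witnesses_U1 X c -> filter_of_coloring c X T -> [set: Th] #<= T.
Proof.
move=> hK hX XK [_ _ Threg] hc [A Abd AT]; apply: Threg => epsilon.
have KA : [set: K] #<= A.
  by case: Abd => _ /card_eqPle[].
have [sigma [B [BA Bs BK]]] :=
  homogenize hK hX XK KA (bounded_family_card hX Abd).
have tB : trivIset B id by apply: sub_trivIset BA _; case: Abd.
have [ab [tau [Bab etau cab]]] := hc sigma B Bs tB BK epsilon.
exists tau; last exact: ltW.
by apply/AT/(rectangle_colorsS BA); exists ab.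
Qed.

(** Otherwise picking in each nonempty member an element below x would be an
    injection, by disjointness, of a family of size K into a bounded set. *)
Lemma disjoint_family_avoids d (K : orderType d) (A : set (set K)) (x : K) :
  infinite_regular_cardinal K -> trivIset A id -> [set: K] #<= A ->
  exists a, [/\ A a, a !=set0 & a `&` below x = set0].
Proof.
move=> hK tA KA; apply: contrapT => nA.
(* The empty set, which may belong to A, is sent to the default x, an element
   not below x. *)
pose f (a : set K) := xget x (a `&` below x).
have Af a : A a -> a !=set0 -> (a `&` below x) (f a).
  move=> Aa a0; apply: (@xgetPex _ x (a `&` below x)).
  by apply/set0P/negP => /eqP ax; apply: nA; exists a.
have f0 : f set0 = x by rewrite /f; case: xgetP => // y _ [].
have fx a : A a -> a !=set0 -> f a != x.
  by move=> Aa a0; have [_ fax] := Af _ Aa a0; rewrite (lt_eqF fax).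
have finj : {in A &, injective f}.
  move=> a b; rewrite !inE => Aa Ab fab.
  have [a0|/set0P a0] := eqVneq a set0; have [b0|/set0P b0] := eqVneq b set0.
  - by rewrite a0 b0.
  - by have := fx _ Ab b0; rewrite -fab a0 f0 eqxx.
  - by have := fx _ Aa a0; rewrite fab b0 f0 eqxx.
  - apply: tA => //; exists (f a); split; first by case: (Af _ Aa a0).
    by rewrite fab; case: (Af _ Ab b0).
have [y xy] := regular_no_max x hK.
apply: (@card_le_regular_below _ K _ A y hK _ KA).
rewrite -(card_le_eql (inj_card_eq finj)); apply: subset_card_le => _ [a Aa <-].
have [->|/set0P a0] := eqVneq a set0; first by rewrite f0.
by apply: lt_trans xy; case: (Af _ Aa a0).
Qed.

(** The regularity of X makes a union of fewer than X pieces smaller than X.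
    That of K bounds the union of fewer than K small sets, so that a disjoint
    family of size less than K can be extended. *)
Lemma amalgamate dK (K : orderType dK) dX (X : orderType dX) I (D : set I)
    (fam : I -> set (set K)) :
  infinite_regular_cardinal K -> infinite_regular_cardinal X ->
  card_lt [set: X] [set: K] -> D !=set0 -> card_lt D [set: X] ->
  (forall i, D i -> bounded_families X (fam i)) ->
  exists2 B, bounded_families X B & forall b, B b -> exists2 g : I -> set K,
    (forall i, D i -> fam i (g i) /\ g i !=set0) & b = \bigcup_(i in D) g i.
Proof.
move=> hK hX XK [i0 Di0] [DX nXD] bfam.
have nKX : ~ ([set: K] #<= [set: X]) by case: XK.
have nKD : ~ ([set: K] #<= D) by move=> /card_le_trans/(_ DX).
pose good : set (set K) := [set b | exists2 g : I -> set K,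
  (forall i, D i -> fam i (g i) /\ g i !=set0) & b = \bigcup_(i in D) g i].
have gsmall b : good b -> ~ ([set: X] #<= b).
  move=> [g gfam ->] Xg.
  have [i Di Xgi] := pigeonhole hX nXD Xg (@subset_refl _ _).
  apply: (bounded_family_card hX (bfam _ Di) (gfam _ Di).1).
  by apply: card_le_trans Xgi _; exact: subset_card_le.
have [M [Mgood tM Mmax]] := @ex_maximal_disjoint_subcollection _ _ id good.
have KM : [set: K] #<= M.
  apply: contrapT => nKM.
  have /not_cofinalP[x Mx] : ~ cofinal (\bigcup_(b in M) b).
    move=> /(cofinal_bigcup hK nKM)[b /Mgood[g gfam ->]].
    move=> /(cofinal_bigcup hK nKD)[i Di cofgi].
    have Kgi : [set: K] #<= g i by case: hK => _ _; exact.
    have [_ _ [nu [nuP _]]] := bfam _ Di.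
    have ginu := nuP _ (gfam _ Di).1.
    by apply: nKX; apply: card_le_trans Kgi (card_le_trans ginu (card_leT _)).
  have avoid i : exists a, D i -> [/\ fam i a, a !=set0 & a `&` below x = set0].
    have [Di|nDi] := pselect (D i); last by exists set0.
    have [tfam /card_eqPle[_ Kfam] _] := bfam _ Di.
    by have [a aP] := disjoint_family_avoids x hK tfam Kfam; exists a.
  have [g gP] := choice avoid.
  (* This union lies above every member of M and contradicts maximality. *)
  pose b := \bigcup_(i in D) g i.
  have bx : b `&` below x = set0.
    rewrite -subset0 => y [[i Di giy] yx].
    by have [_ _ <-] := gP _ Di.
  have [y gi0y] : g i0 !=set0 by have [] := gP _ Di0.
  have b_y : b y by exists i0.
  have nMb : ~ M b.
    by move=> Mb; rewrite -[False]/(set0 y) -bx; split => //; apply: Mx; exists b.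
  apply: (Mmax (M `|` [set b])).
  - by split=> [a Ma|h]; [left|apply: nMb; apply: h; right].
  - move=> a [/Mgood//|->]; exists g => // i Di.
    by have [] := gP _ Di.
  - have bM a : M a -> a `&` b !=set0 -> False.
      move=> Ma [z [az bz]]; rewrite -[False]/(set0 z) -bx; split => //.
      by apply: Mx; exists a.
    move=> a1 a2 [Ma1|->] [Ma2|->] //=; first exact: tM.
      by move=> /(bM _ Ma1).
    by rewrite setIC => /(bM _ Ma2).
have [B BM Bbd] := bounded_subfamily hK hX XK tM KM (fun b Mb => gsmall b (Mgood b Mb)).
by exists B => // b /BM/Mgood.
Qed.

(** A homogeneous rectangle over two amalgamated sets restricts to one of the
    same colour over their pieces; the pieces being nonempty, the colour is
    attained there. *)
Lemma filter_of_coloring_bigcap dK (K : orderType dK) C (c : coloring K C)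
    dX (X : orderType dX) (G : set_system C) :
  infinite_regular_cardinal K -> infinite_regular_cardinal X ->
  card_lt [set: X] [set: K] -> G !=set0 -> card_lt G [set: X] ->
  G `<=` filter_of_coloring c X -> filter_of_coloring c X (\bigcap_(T in G) T).
Proof.
move=> hK hX XK G0 GX GF.
have ex T : exists A, G T -> bounded_families X A /\ rectangle_colors c A `<=` T.
  have [/GF[A Abd AT]|nGT] := pselect (G T); first by exists A.
  by exists set0.
have [fam famP] := choice ex.
have [B Bbd Bfam] := amalgamate hK hX XK G0 GX (fun T GT => (famP T GT).1).
exists B => // tau [[a b] [/= /Bfam[g gP ->] /Bfam[h hP ->] gh] cgh] T GT.
have [gT [x gx]] := gP _ GT; have [hT [y hy]] := hP _ GT.
have sub (k : set C -> set K) : k T `<=` \bigcup_(S in G) k S.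
  by move=> z kz; exists T.
have ghT : set_lt (g T) (h T).
  by move=> u v /(sub g) gu /(sub h) hv; exact: gh.
apply: (famP _ GT).2; exists (g T, h T) => //=.
apply/seteqP; split => [_ [p [gp hp] <-]|_ ->].
  rewrite -cgh; exists p => //; split; [exact: (sub g)|exact: (sub h)].
have xy : x < y by exact: ghT.
have : [set tau] (c (exist _ (x, y) xy)).
  by rewrite -cgh; exists (exist _ (x, y) xy) => //; split; [exact: (sub g)|exact: (sub h)].
by move=> <-; exists (exist _ (x, y) xy).
Qed.

Lemma filter_of_coloringS dK (K : orderType dK) C (c : coloring K C)
    dX (X : orderType dX) (S T : set C) :
  S `<=` T -> filter_of_coloring c X S -> filter_of_coloring c X T.
Proof. by move=> ST [A Abd AS]; exists A => //; exact: subset_trans AS ST. Qed.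

Lemma finite_card_lt T (A : set T) U (B : set U) :
  finite_set A -> infinite_set B -> card_lt A B.
Proof.
move=> Afin Binf; split; last by move=> /card_le_finite/(_ Afin).
have [n /card_eqPle[An _]] := Afin.
apply: card_le_trans An _; apply: card_le_trans (card_leT _) _.
exact/infiniteP.
Qed.

(** The singletons form a bounded family. *)
Lemma filter_of_coloringT dK (K : orderType dK) C (c : coloring K C)
    dX (X : orderType dX) :
  infinite_regular_cardinal K -> infinite_regular_cardinal X ->
  card_lt [set: X] [set: K] -> filter_of_coloring c X [set: C].
Proof.
move=> hK hX XK.
have [|||B _ Bbd] := @bounded_subfamily _ K _ X (range set1) hK hX XK.
- by move=> _ _ [x _ <-] [y _ <-] [z [-> ->]].
- have s1inj : {in [set: K] &, injective (@set1 K)}.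
    by move=> x y _ _ xy; have : [set y] x by rewrite -xy.
  by rewrite (card_le_eqr (inj_card_eq s1inj)).
- move=> _ [x _ <-] /card_le_finite/(_ (finite_set1 _)).
  by case: hX.
by exists B.
Qed.

(** * Complete uniform filters and Pr_1 *)

Theorem proposition4p2
    (dK dT dX dL : Order.disp_t)
    (kappa : orderType dK) (theta : orderType dT)
    (chi : orderType dX) (lambda : orderType dL)
    (hkappa : infinite_regular_cardinal kappa)
    (hchi : infinite_regular_cardinal chi)
    (chi_lt_kappa : card_lt [set: chi]%classic [set: kappa]%classic)
    (htheta : infinite_regular_cardinal theta)
    (theta_le_kappa : ([set: theta]%classic #<= [set: kappa]%classic)%card)
    (c : coloring kappa theta)
    (hc : witnesses_U1 chi c)
    (hlambda : is_cardinal lambda) :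
  complete_uniform_filter chi (filter_of_coloring c chi) /\
  ((forall F : set_system theta,
      complete_uniform_filter chi F -> ~ weakly_saturated lambda F) ->
   Pr1 kappa lambda chi).
Proof.
have big T : filter_of_coloring c chi T -> [set: theta] #<= T.
  exact: filter_of_coloring_card_ge.
have complete : complete_filter chi (filter_of_coloring c chi).
  move=> G GF Gchi; have [->|/set0P G0] := eqVneq G set0.
    by rewrite bigcap_set0; exact: filter_of_coloringT.
  exact: filter_of_coloring_bigcap.
have theta_inf : infinite_set [set: theta] by case: htheta.
have cuf : complete_uniform_filter chi (filter_of_coloring c chi).
  split => //; last first.
    by move=> T /big thT; apply/card_eqPle; split => //; exact: card_leT.
  split.
    by move=> /big /card_le_finite/(_ (finite_set0 _)).
  split; [exact: filter_of_coloringT| |exact: filter_of_coloringS].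
  move=> S T FS FT.
  have -> : S `&` T = \bigcap_(U in [set S; T]) U.
    by rewrite bigcap_setU !bigcap_set1.
  apply: complete => [U [->|->]//|].
  by apply: finite_card_lt; [exact: finite_set2|case: hchi].
split => // /(_ _ cuf) /contrapT[P [[Pcover tP _] Ppos]].
have part t : exists i, P i t.
  have [i _ Pit] : cover [set: lambda] P t by rewrite Pcover.
  by exists i.
have [color colorP] := choice part.
exists (color \o c) => sigma A As tA AK tau.
have Abd : bounded_families chi A.
  by apply: (bounded_family_of_type (sigma := sigma)) => //; case: hchi => [[]].
have [t [[ab Aab cab] Pt]] : rectangle_colors c A `&` P tau !=set0.
  apply: contrapT => AP; apply: (Ppos tau); exists A => // t At.
  (* In the definition of positive sets the complement is that of the lattice
     of sets; it is convertible to the negation. *)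
  change (~ P tau t) => Pt; by apply: AP; exists t.
exists ab => //.
have -> : tau = color t.
  apply: contrapT => tauN; have := tP tau (color t) I I.
  by move=> /(_ (ex_intro _ t (conj Pt (colorP t)))).
rewrite /rectangle_image -image_comp -/(rectangle_image c ab.1 ab.2) cab.
exact: image_set1.
Qed.
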